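(* Let $r,s\ge 1$ and let $t,u\ge 0$ be integers with $t+u\ge 1$. If the pseudo $H$-type Lie algebra $\mathfrak n_{r,s}$ is isomorphic, as a Lie algebra, to $\mathfrak n_{t,u}$, then $(t,u)=(r,s)$ or $(t,u)=(s,r)$. In other words, the only pseudo $H$-type Lie algebra $\mathfrak n_{t,u}$ other than $\mathfrak n_{r,s}$ itself to which $\mathfrak n_{r,s}$ can be isomorphic is $\mathfrak n_{s,r}$.
   Context: For integers $r,s\ge 0$ with $r+s\ge1$, $\mathbb R^{r,s}$ is $\mathbb R^{r+s}$ with $\langle Z,W\rangle_{r,s}=\sum_{i=1}^r Z_iW_i-\sum_{j=r+1}^{r+s}Z_jW_j$, and $\mathrm{Cl}_{r,s}$ is the real unital associative algebra generated by $\mathbb R^{r,s}$ subject to $Z\otimes Z=-\langle Z,Z\rangle_{r,s}\,1$. A scalar product is a non-degenerate (possibly indefinite) symmetric bilinear form. An admissible $\mathrm{Cl}_{r,s}$-module is a non-zero finite-dimensional real vector space $\mathfrak v$ with a representation $J:\mathrm{Cl}_{r,s}\to\mathrm{End}(\mathfrak v)$ and a scalar product $\langle\cdot,\cdot\rangle_{\mathfrak v}$ such that $\langle J_Zv,w\rangle_{\mathfrak v}=-\langle v,J_Zw\rangle_{\mathfrak v}$ for all $Z\in\mathbb R^{r,s}$, $v,w\in\mathfrak v$. It is minimal if its dimension is minimal among admissible $\mathrm{Cl}_{r,s}$-modules. The associated pseudo $H$-type Lie algebra is $\mathfrak n=\mathfrak v\oplus\mathbb R^{r,s}$ (orthogonal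 sum), with center $\mathbb R^{r,s}$ and bracket $[\cdot,\cdot]:\mathfrak v\times\mathfrak v\to\mathbb R^{r,s}$ determined by $\langle J_Zv,w\rangle_{\mathfrak v}=\langle Z,[v,w]\rangle_{r,s}$ for all $Z\in\mathbb R^{r,s}$, $v,w\in\mathfrak v$. The notation $\mathfrak n_{r,s}=\mathfrak v_{r,s}\oplus\mathfrak z_{r,s}$, $\mathfrak z_{r,s}=\mathbb R^{r,s}$, stands for the pseudo $H$-type Lie algebra built from a minimal admissible module $\mathfrak v_{r,s}$ (for $s=0$ the scalar product on $\mathfrak v_{r,0}$ is positive definite). Isomorphisms are isomorphisms of Lie algebras, with no condition on scalar products. *)

(* Defs.v *)
From HB Require Import structures.
From mathcomp Require Import all_boot all_order all_algebra.
From mathcomp Require Import boolp reals.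

Set Implicit Arguments.
Unset Strict Implicit.
Unset Printing Implicit Defensive.

Import Order.TTheory GRing.Theory Num.Theory.

Local Open Scope ring_scope.
Local Open Scope quotient_scope.

Section PseudoEuclidean.
Variables (R : realType) (r s : nat).
Implicit Types Z W : 'rV[R]_(r + s).

(* The first r coordinates (lshift) are the positive ones. *)
Definition scal_rs Z W : R :=
  \sum_(i < r) Z 0 (lshift s i) * W 0 (lshift s i)
  - \sum_(j < s) Z 0 (rshift r j) * W 0 (rshift r j).

Lemma scal_rsC Z W : scal_rs Z W = scal_rs W Z.
Proof. by congr (_ - _); apply: eq_bigr => i _; rewrite mulrC. Qed.

Lemma scal_rsDZl a Z1 Z2 W :
  scal_rs (a *: Z1 + Z2) W = a * scal_rs Z1 W + scal_rs Z2 W.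
Proof.
rewrite /scal_rs mulrBr addrACA -opprD !mulr_sumr -!big_split /=.
by congr (_ - _); apply: eq_bigr => i _; rewrite !mxE mulrDl mulrA.
Qed.

Lemma scal_rs_delta Z k : scal_rs Z 'e_k = Z 0 k * scal_rs 'e_k 'e_k.
Proof.
rewrite /scal_rs mulrBr !mulr_sumr; congr (_ - _); apply: eq_bigr => i _;
  by rewrite !mxE /=; case: eqP => [->|_]; rewrite ?mulr0 // !mulr1.
Qed.

Lemma scal_rs_delta_sqr k : scal_rs 'e_k 'e_k * scal_rs 'e_k 'e_k = 1.
Proof.
rewrite /scal_rs; case: (split_ordP k) => j ->.
  rewrite (bigD1 j) //= !mxE !eqxx mulr1 !big1 ?addr0 ?subr0 ?mulr1 //.
    by move=> i _; rewrite !mxE eq_rlshift andbF mulr0.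
  by move=> i ij; rewrite !mxE eq_lshift (negPf ij) andbF mulr0.
rewrite (bigD1 j erefl (F := fun j0 => 'e__ _ (rshift r j0) * _)) /=.
rewrite !mxE !eqxx mulr1 !big1 ?addr0 ?sub0r ?mulrNN ?mulr1 //.
  by move=> i ij; rewrite !mxE eq_rshift (negPf ij) andbF mulr0.
by move=> i _; rewrite !mxE eq_lrshift andbF mulr0.
Qed.

Lemma scal_rs_row Z W : scal_rs Z W =
  \sum_k scal_rs 'e_k 'e_k * (Z 0 k * W 0 k).
Proof.
rewrite {1}(row_sum_delta W) scal_rsC.
elim/big_rec2: _ => [|k x y _ IH].
  by rewrite /scal_rs !big1 ?subr0 // => i _; rewrite mxE mul0r.
by rewrite scal_rsDZl IH scal_rsC scal_rs_delta mulrA mulrC [W 0 k * _]mulrC.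
Qed.

End PseudoEuclidean.

(* Cl_{r,s} by generators and relations: formal expressions in the vectors of  *)
(* R^{r,s} and the real scalars, modulo the smallest congruence that makes     *)
(* them a unital associative R-algebra, in which the generators depend         *)
(* linearly on Z and satisfy Z * Z = - <Z, Z>_{r,s}.                           *)
Section Clifford.
Variables (R : realType) (r s : nat).

Inductive cliff_expr : Type :=
| CVec of 'rV[R]_(r + s)
| CScal of R
| CAdd of cliff_expr & cliff_expr
| CMul of cliff_expr & cliff_expr.

Inductive cliff_cong : cliff_expr -> cliff_expr -> Prop :=
| cc_refl x : cliff_cong x x
| cc_sym x y : cliff_cong x y -> cliff_cong y x
| cc_trans y x z : cliff_cong x y -> cliff_cong y z -> cliff_cong x z
| cc_add x x' y y' : cliff_cong x x' -> cliff_cong y y' ->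
    cliff_cong (CAdd x y) (CAdd x' y')
| cc_mul x x' y y' : cliff_cong x x' -> cliff_cong y y' ->
    cliff_cong (CMul x y) (CMul x' y')
| cc_addA x y z : cliff_cong (CAdd x (CAdd y z)) (CAdd (CAdd x y) z)
| cc_addC x y : cliff_cong (CAdd x y) (CAdd y x)
| cc_add0 x : cliff_cong (CAdd (CScal 0) x) x
| cc_mulA x y z : cliff_cong (CMul x (CMul y z)) (CMul (CMul x y) z)
| cc_mul1 x : cliff_cong (CMul (CScal 1) x) x
| cc_mul0 x : cliff_cong (CMul (CScal 0) x) (CScal 0)
| cc_mulDl x y z :
    cliff_cong (CMul (CAdd x y) z) (CAdd (CMul x z) (CMul y z))
| cc_mulDr x y z :
    cliff_cong (CMul x (CAdd y z)) (CAdd (CMul x y) (CMul x z))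
| cc_scalD a b : cliff_cong (CScal (a + b)) (CAdd (CScal a) (CScal b))
| cc_scalM a b : cliff_cong (CScal (a * b)) (CMul (CScal a) (CScal b))
| cc_scalC a x : cliff_cong (CMul (CScal a) x) (CMul x (CScal a))
| cc_lin a Z W : cliff_cong (CVec (a *: Z + W))
    (CAdd (CMul (CScal a) (CVec Z)) (CVec W))
| cc_sqr Z : cliff_cong (CMul (CVec Z) (CVec Z)) (CScal (- scal_rs Z Z)).

HB.instance Definition _ := gen_eqMixin cliff_expr.
HB.instance Definition _ := gen_choiceMixin cliff_expr.

Definition cliff_congb : rel cliff_expr := [rel x y | `[< cliff_cong x y >]].

Lemma cliff_congb_equiv : equiv_class_of cliff_congb.
Proof.
split=> [x|x y|y x z]; first exact/asboolP/cc_refl.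
  by apply/asboolP/asboolP; apply: cc_sym.
by move=> /asboolP xy /asboolP yz; apply/asboolP/(cc_trans xy).
Qed.

Canonical cliff_equivRel := EquivRelPack cliff_congb_equiv.

Definition clifford : Type := {eq_quot cliff_equivRel}.
HB.instance Definition _ := Choice.on clifford.
HB.instance Definition _ := EqQuotient.on clifford.

Lemma cliff_piE x y : cliff_cong x y <-> \pi_(clifford) x = \pi_(clifford) y.
Proof.
split=> [xy|/eqquotP /asboolP //]; exact/eqquotP/asboolP.
Qed.

Lemma cliff_reprK x : cliff_cong (repr (\pi_(clifford) x)) x.
Proof. by apply/cliff_piE; rewrite reprK. Qed.

Definition cliff_scal (a : R) : clifford := \pi_(clifford) (CScal a).
Definition cliff_add (x y : clifford) : clifford := \pi_(clifford) (CAdd (repr x) (repr y)).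
Definition cliff_mul (x y : clifford) : clifford := \pi_(clifford) (CMul (repr x) (repr y)).
Definition cliff_opp (x : clifford) := cliff_mul (cliff_scal (-1)) x.

Lemma cliff_addE x y :
  cliff_add (\pi_(clifford) x) (\pi_(clifford) y) = \pi_(clifford) (CAdd x y).
Proof. by apply/cliff_piE/cc_add; apply: cliff_reprK. Qed.

Lemma cliff_mulE x y :
  cliff_mul (\pi_(clifford) x) (\pi_(clifford) y) = \pi_(clifford) (CMul x y).
Proof. by apply/cliff_piE/cc_mul; apply: cliff_reprK. Qed.

Lemma cliff_addA : associative cliff_add.
Proof.
elim/quotW=> x; elim/quotW=> y; elim/quotW=> z; rewrite (cliff_addE y z) (cliff_addE x y) !cliff_addE.
exact/cliff_piE/cc_addA.
Qed.

Lemma cliff_addC : commutative cliff_add.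
Proof.
by elim/quotW=> x; elim/quotW=> y; rewrite !cliff_addE; apply/cliff_piE/cc_addC.
Qed.

Lemma cliff_add0 : left_id (cliff_scal 0) cliff_add.
Proof. by elim/quotW=> x; rewrite cliff_addE; apply/cliff_piE/cc_add0. Qed.

Lemma cliff_mulA : associative cliff_mul.
Proof.
elim/quotW=> x; elim/quotW=> y; elim/quotW=> z; rewrite (cliff_mulE y z) (cliff_mulE x y) !cliff_mulE.
exact/cliff_piE/cc_mulA.
Qed.

Lemma cliff_mul1l : left_id (cliff_scal 1) cliff_mul.
Proof. by elim/quotW=> x; rewrite cliff_mulE; apply/cliff_piE/cc_mul1. Qed.

Lemma cliff_mul0l x : cliff_mul (cliff_scal 0) x = cliff_scal 0.
Proof. by elim/quotW: x => x; rewrite cliff_mulE; apply/cliff_piE/cc_mul0. Qed.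

Lemma cliff_scalC a x : cliff_mul (cliff_scal a) x = cliff_mul x (cliff_scal a).
Proof. by elim/quotW: x => x; rewrite !cliff_mulE; apply/cliff_piE/cc_scalC. Qed.

Lemma cliff_mul1r : right_id (cliff_scal 1) cliff_mul.
Proof. by move=> x; rewrite -cliff_scalC cliff_mul1l. Qed.

Lemma cliff_mulDl : left_distributive cliff_mul cliff_add.
Proof.
elim/quotW=> x; elim/quotW=> y; elim/quotW=> z; rewrite (cliff_addE x y) (cliff_mulE x z) (cliff_mulE y z) cliff_addE cliff_mulE.
exact/cliff_piE/cc_mulDl.
Qed.

Lemma cliff_mulDr : right_distributive cliff_mul cliff_add.
Proof.
elim/quotW=> x; elim/quotW=> y; elim/quotW=> z; rewrite (cliff_addE y z) (cliff_mulE x y) (cliff_mulE x z) cliff_addE cliff_mulE.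
exact/cliff_piE/cc_mulDr.
Qed.

Lemma cliff_scalD a b :
  cliff_scal (a + b) = cliff_add (cliff_scal a) (cliff_scal b).
Proof. by rewrite cliff_addE; apply/cliff_piE/cc_scalD. Qed.

Lemma cliff_scalM a b :
  cliff_scal (a * b) = cliff_mul (cliff_scal a) (cliff_scal b).
Proof. by rewrite cliff_mulE; apply/cliff_piE/cc_scalM. Qed.

Lemma cliff_addN : left_inverse (cliff_scal 0) cliff_opp cliff_add.
Proof.
move=> x; rewrite /cliff_opp -{2}[x]cliff_mul1l -cliff_mulDl -cliff_scalD.
by rewrite addNr cliff_mul0l.
Qed.

HB.instance Definition _ := GRing.isZmodule.Build clifford
  cliff_addA cliff_addC cliff_add0 cliff_addN.

End Clifford.

(* A matrix model of the Clifford relations, showing that 1 != 0 in Cl_{r,s}. *)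
Lemma cliff_matrices (R : realType) n (d : 'I_n -> R) :
  exists m (E : 'rV[R]_n -> 'M[R]_m.+1),
    (forall a Z W, E (a *: Z + W) = a *: E Z + E W) /\
    (forall Z, E Z *m E Z = (\sum_i d i * Z 0 i ^+ 2)%:M).
Proof.
elim: n d => [|n IHn] d.
  exists 0%N, (fun=> 0); split=> [a Z W|Z]; first by rewrite scaler0 addr0.
  by rewrite big_ord0 mulmx0 -scalemx1 scale0r.
have [m [E [Elin Esqr]]] := IHn (fun i => d (lift ord0 i)).
pose tl (Z : 'rV[R]_n.+1) := \row_j Z 0 (lift ord0 j).
pose F Z : 'M[R]_(m.+1 + m.+1) :=
  block_mx (E (tl Z)) (d ord0 * Z 0 0)%:M (Z 0 0)%:M (- E (tl Z)).
suff [Flin Fsqr] : (forall a Z W, F (a *: Z + W) = a *: F Z + F W) /\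
    (forall Z, F Z *m F Z = (\sum_i d i * Z 0 i ^+ 2)%:M).
  by exists (m + m.+1)%N, F.
split=> [a Z W|Z]; rewrite /F.
  have -> : tl (a *: Z + W) = a *: tl Z + tl W by apply/rowP => j; rewrite !mxE.
  rewrite Elin scale_block_mx add_block_mx scalerN opprD !mxE mulrDr.
  by rewrite mulrCA !raddfD /= !scale_scalar_mx.
rewrite mulmx_block !mulmxN !mulNmx opprK !Esqr -!scalar_mxM.
rewrite !mul_scalar_mx !mul_mx_scalar !subrr -!raddfD /=.
rewrite mulrCA -mulrA [X in block_mx _ _ _ X%:M]addrC.
rewrite -scalar_mx_block; congr (_%:M); rewrite big_ord_recl.
rewrite (eq_bigr (fun i => d (lift ord0 i) * Z 0 (lift ord0 i) ^+ 2)).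
  by rewrite addrC expr2 mulrA.
by move=> i _; rewrite mxE.
Qed.

Section CliffordAlgebra.
Variables (R : realType) (r s : nat).
Local Notation Cl := (clifford R r s).

Lemma cliff_nontrivial : cliff_scal r s 1 != 0 :> Cl.
Proof.
have [m [E [Elin Esqr]]] := cliff_matrices
  (fun k : 'I_(r + s) => - scal_rs 'e_k ('e_k : 'rV[R]_(r + s))).
pose fix ev (x : cliff_expr R r s) : 'M[R]_m.+1 := match x with
  | CVec Z => E Z | CScal a => a%:M
  | CAdd x y => ev x + ev y | CMul x y => ev x *m ev y end.
have evP x y : cliff_cong x y -> ev x = ev y.
  elim=> {x y}/=; try by [].
  - by move=> y x z _ -> _ ->.
  - by move=> x x' y y' _ -> _ ->.
  - by move=> x x' y y' _ -> _ ->.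
  - by move=> x y z; rewrite addrA.
  - by move=> x y; rewrite addrC.
  - by move=> x; rewrite -scalemx1 scale0r add0r.
  - by move=> x y z; rewrite mulmxA.
  - by move=> x; rewrite mul1mx.
  - by move=> x; rewrite mul_scalar_mx -scalemx1 !scale0r.
  - by move=> x y z; rewrite mulmxDl.
  - by move=> x y z; rewrite mulmxDr.
  - by move=> a b; rewrite raddfD.
  - by move=> a b; rewrite scalar_mxM.
  - by move=> a x; rewrite mul_scalar_mx mul_mx_scalar.
  - by move=> a Z W; rewrite Elin mul_scalar_mx.
  - move=> Z; rewrite Esqr (scal_rs_row Z) -sumrN; congr (_%:M).
    by apply: eq_bigr => k _; rewrite mulNr.
apply/eqP => /cliff_piE/evP /= /matrixP/(_ 0 0)/eqP.
by rewrite !mxE eqxx oner_eq0.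
Qed.

HB.instance Definition _ := GRing.Zmodule_isNzRing.Build Cl
  (@cliff_mulA R r s) (@cliff_mul1l R r s) (@cliff_mul1r R r s)
  (@cliff_mulDl R r s) (@cliff_mulDr R r s) cliff_nontrivial.

Definition cliff_scale (a : R) (x : Cl) : Cl := cliff_scal r s a * x.

Lemma cliff_scaleA a b x :
  cliff_scale a (cliff_scale b x) = cliff_scale (a * b) x.
Proof. by rewrite /cliff_scale mulrA; congr (_ * _); rewrite cliff_scalM. Qed.

Lemma cliff_scale1 : left_id 1 cliff_scale.
Proof. exact: cliff_mul1l. Qed.

Lemma cliff_scaleDr : right_distributive cliff_scale +%R.
Proof. by move=> a x y; rewrite /cliff_scale mulrDr. Qed.

Lemma cliff_scaleDl x : {morph cliff_scale^~ x : a b / a + b}.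
Proof.
by move=> a b; rewrite /cliff_scale -mulrDl; congr (_ * _); rewrite cliff_scalD.
Qed.

HB.instance Definition _ := GRing.Zmodule_isLmodule.Build R Cl
  cliff_scaleA cliff_scale1 cliff_scaleDr cliff_scaleDl.

Lemma cliff_scaleAl (a : R) (x y : Cl) : a *: (x * y) = a *: x * y.
Proof. exact: mulrA. Qed.

HB.instance Definition _ := GRing.Lmodule_isLalgebra.Build R Cl cliff_scaleAl.

Lemma cliff_scaleAr (a : R) (x y : Cl) : a *: (x * y) = x * (a *: y).
Proof.
rewrite -[LHS]/(cliff_scal r s a * (x * y)) -[in RHS]/(cliff_scal r s a * y).
by rewrite !mulrA; congr (_ * _); apply: cliff_scalC.
Qed.

HB.instance Definition _ := GRing.Lalgebra_isAlgebra.Build R Cl cliff_scaleAr.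

Definition cliff_vec (Z : 'rV[R]_(r + s)) : Cl := \pi_Cl (CVec Z).

Lemma cliff_vec_is_linear : linear cliff_vec.
Proof.
move=> a Z W; transitivity (cliff_add
  (cliff_mul (cliff_scal r s a) (cliff_vec Z)) (cliff_vec W)); last by [].
by rewrite cliff_mulE cliff_addE; apply/cliff_piE/cc_lin.
Qed.

HB.instance Definition _ :=
  GRing.isLinear.Build R 'rV[R]_(r + s) Cl _ cliff_vec cliff_vec_is_linear.

Lemma cliff_vec_sqr Z : cliff_vec Z * cliff_vec Z = (- scal_rs Z Z)%:A.
Proof.
rewrite -[RHS]/(cliff_scal r s (- scal_rs Z Z) * 1) mulr1.
transitivity (cliff_mul (cliff_vec Z) (cliff_vec Z)); first by [].
by rewrite cliff_mulE; apply/cliff_piE/cc_sqr.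
Qed.

End CliffordAlgebra.

Record admissibleModule (R : realType) (r s : nat) := AdmissibleModule {
  adm_space :> vectType R;
  adm_rep : {linear clifford R r s -> 'End(adm_space)};
  adm_form : {symmetric adm_space};
  adm_neq0 : (0 < dim adm_space)%N;
  adm_rep1 : adm_rep 1 = \1%VF;
  adm_repM : forall x y, adm_rep (x * y) = (adm_rep x \o adm_rep y)%VF;
  adm_nondegenerate : nondegenerate adm_form;
  adm_skew : forall (Z : 'rV[R]_(r + s)) (v w : adm_space),
    adm_form (adm_rep (cliff_vec Z) v) w
    = - adm_form v (adm_rep (cliff_vec Z) w)
}.

Section Minimal.
Variables (R : realType) (r s : nat) (M : admissibleModule R r s).

Definition minimal_admissible : Prop :=
  forall N : admissibleModule R r s, (dim M <= dim N)%N.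

(* The modules v_{r,s} from which n_{r,s} is built: by convention the scalar   *)
(* product on v_{r,0} is positive definite.                                    *)
Definition standard_minimal : Prop :=
  minimal_admissible /\
  (s = 0%N -> forall v : M, v != 0 -> 0 < adm_form M v v).

End Minimal.

Record lieAlgebra (K : fieldType) := LieAlgebra {
  lie_space :> vectType K;
  lie_bracket : {bilinear lie_space -> lie_space -> lie_space};
  lie_alternating : forall x, lie_bracket x x = 0;
  lie_jacobi : forall x y z,
    lie_bracket x (lie_bracket y z) + lie_bracket y (lie_bracket z x)
    + lie_bracket z (lie_bracket x y) = 0
}.

Definition lie_isomorphic (K : fieldType) (L1 L2 : lieAlgebra K) : Prop :=
  exists f : {linear L1 -> L2},
    bijective f /\
    forall x y, f (lie_bracket L1 x y) = lie_bracket L2 (f x) (f y).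

Section PseudoHType.
Variables (R : realType) (r s : nat) (M : admissibleModule R r s).

Definition adm_J (Z : 'rV[R]_(r + s)) : 'End(M) := adm_rep M (cliff_vec Z).

(* The coordinates of [v, w] in the basis e_k, obtained by taking Z = e_k in   *)
(* <J_Z v, w> = <Z, [v, w]>_{r,s} and using <e_k, e_k>_{r,s} = 1 or -1.        *)
(* pseudoH_centralP says that this is the bracket determined by that identity. *)
Definition pseudoH_central (v w : M) : 'rV[R]_(r + s) :=
  \row_k (scal_rs 'e_k ('e_k : 'rV[R]_(r + s)) * adm_form M (adm_J 'e_k v) w).

Lemma pseudoH_centralP (v w : M) (U : 'rV[R]_(r + s)) :
  (forall Z, adm_form M (adm_J Z v) w = scal_rs Z U) <->
  U = pseudoH_central v w.
Proof.
split=> [UP|-> Z].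
  apply/rowP => k; rewrite mxE UP [scal_rs _ U]scal_rsC (scal_rs_delta U) mulrCA.
  by rewrite scal_rs_delta_sqr mulr1.
rewrite scal_rs_row {1}(row_sum_delta Z) /adm_J !linear_sum /=.
rewrite sum_lfunE linear_sumlz; apply: eq_bigr => k _.
rewrite !linearZ /= scale_lfunE linearZl_LR /= mxE.
by rewrite [RHS]mulrCA [scal_rs _ _ * (_ * _)]mulrA scal_rs_delta_sqr mul1r.
Qed.

Definition pseudoH_bracket (x y : (M * 'rV[R]_(r + s))%type) :
  (M * 'rV[R]_(r + s))%type := (0, pseudoH_central x.1 y.1).

Lemma pseudoH_bracket_is_bilinear :
  bilinear_for ( *:%R : R -> _ -> _) ( *:%R : R -> _ -> _) pseudoH_bracket.
Proof.
split=> u a x y; rewrite /pseudoH_bracket; congr (_, _);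
  rewrite /= ?scaler0 ?addr0 //; apply/rowP => k; rewrite !mxE /=.
  by rewrite linearP linearPl /= mulrDr mulrCA.
by rewrite linearPr /= mulrDr mulrCA.
Qed.

HB.instance Definition _ := bilinear_isBilinear.Build R
  (M * 'rV[R]_(r + s))%type (M * 'rV[R]_(r + s))%type (M * 'rV[R]_(r + s))%type
  _ _ pseudoH_bracket pseudoH_bracket_is_bilinear.

Lemma pseudoH_alternating x : pseudoH_bracket x x = 0.
Proof.
congr (_, _); apply/rowP => k; rewrite !mxE.
suff -> : adm_form M (adm_J 'e_k x.1) x.1 = 0 by rewrite mulr0.
apply/eqP; rewrite -eqNr; apply/eqP.
by rewrite [RHS]adm_skew [adm_form M x.1 _]hermC /= expr0 mul1r.
Qed.

Lemma pseudoH_jacobi x y z :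
  pseudoH_bracket x (pseudoH_bracket y z)
  + pseudoH_bracket y (pseudoH_bracket z x)
  + pseudoH_bracket z (pseudoH_bracket x y) = 0.
Proof.
suff h u v w : pseudoH_bracket u (pseudoH_bracket v w) = 0.
  by rewrite !h !addr0.
by congr (_, _); apply/rowP => k; rewrite !mxE linear0r mulr0.
Qed.

Definition pseudoH_lie : lieAlgebra R :=
  @LieAlgebra R (M * 'rV[R]_(r + s))%type pseudoH_bracket
    pseudoH_alternating pseudoH_jacobi.

End PseudoHType.

(* Main.v *)
From HB Require Import structures.
Require Import Defs.
From mathcomp Require Import all_boot all_order all_algebra.
From mathcomp Require Import boolp reals.
From mathcomp Require Import ring lra zify.

(** Let f be an isomorphism from n_{r,s} to n_{t,u}.  It preserves the centres,
    so it induces linear bijections A between the quotients v, v' by the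
    centres and C between the centres, with [A v, A w] = C [v, w].  Pairing
    with Z and writing D for the adjoint of C with respect to the two scalar
    products gives
      < J_Z (A v), A w > = < J_{D Z} v, w >,
    so that J_Z is singular exactly when J_{D Z} is.  Since J_Z squares to
    - <Z, Z>, a Clifford multiplication is singular exactly on null vectors.
    Hence D matches the null cones of R^{t,u} and R^{r,s}
    (lemma [lie_isomorphic_null_cones]).

    A linear bijection that matches null cones rescales the quadratic form
    ([null_cone_signature]).  As r, s >= 1 there are nonzero null vectors, so
    t, u >= 1 too.  If p is in the positive and n in the negative summand of
    R^{t,u} with <p, p> + <n, n> = 0, then p + n and p - n are null, hence so
    are their images under D, and the parallelogram identity yields
    <D p, D p> = - <D n, D n>.  Fixing p, then n, one finds a single real
    number lambda with <D x, D x> = lambda <x, x> on both summands.  Comparing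
    dimensions of definite subspaces ([proportional_signature]), as in
    Sylvester's law of inertia, gives t <= r and u <= s if lambda > 0, or
    t <= s and u <= r if lambda < 0; since t + u = r + s, these inequalities
    are equalities. *)

Set Implicit Arguments.
Unset Strict Implicit.
Unset Printing Implicit Defensive.

Import Order.TTheory GRing.Theory Num.Theory.

(** * Null cones determine the signature up to order *)

Section NullCones.
Local Open Scope ring_scope.
Variable R : realType.

Definition scal_gram r s : 'M[R]_(r + s) :=
  diag_mx (\row_k scal_rs 'e_k ('e_k : 'rV[R]_(r + s))).

Lemma scal_rs_gram r s (Z W : 'rV[R]_(r + s)) :
  scal_rs Z W = (Z *m scal_gram r s *m W^T) 0 0.
Proof.
rewrite scal_rs_row mul_mx_diag !mxE; apply: eq_bigr => k _.
by rewrite !mxE; ring.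
Qed.

Lemma scal_gramK r s : scal_gram r s *m scal_gram r s = 1%:M.
Proof.
rewrite mulmx_diag -diag_const_mx; congr diag_mx; apply/rowP => k.
by rewrite !mxE scal_rs_delta_sqr.
Qed.

Lemma tr_scal_gram r s : (scal_gram r s)^T = scal_gram r s.
Proof. exact: tr_diag_mx. Qed.

(** Row vectors are acted on from the right, so the matrix of the adjoint is
    the transpose corrected by the two Gram matrices, each its own inverse. *)
Definition scal_adjoint r s t u (C : 'M[R]_(r + s, t + u)) :
  'M[R]_(t + u, r + s) := scal_gram t u *m C^T *m scal_gram r s.

Lemma scal_adjointP r s t u (C : 'M[R]_(r + s, t + u)) Z U :
  scal_rs (Z *m scal_adjoint C) U = scal_rs Z (U *m C).
Proof.
rewrite !scal_rs_gram trmx_mul /scal_adjoint !mulmxA.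
by rewrite -[_ *m scal_gram r s *m scal_gram r s]mulmxA scal_gramK mulmx1.
Qed.

Lemma scal_adjoint_inv r s t u (C : 'M[R]_(r + s, t + u))
    (C' : 'M[R]_(t + u, r + s)) :
  C *m C' = 1%:M -> scal_adjoint C' *m scal_adjoint C = 1%:M.
Proof.
move=> CC'; rewrite /scal_adjoint !mulmxA.
rewrite -[_ *m scal_gram t u *m scal_gram t u]mulmxA scal_gramK mulmx1.
by rewrite -[_ *m C'^T *m C^T]mulmxA -trmx_mul CC' trmx1 mulmx1 scal_gramK.
Qed.

Definition dot n (x y : 'rV[R]_n) : R := \sum_i x 0 i * y 0 i.

Lemma dot_ge0 n (x : 'rV[R]_n) : 0 <= dot x x.
Proof. by apply: sumr_ge0 => i _; rewrite -expr2 sqr_ge0. Qed.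

Lemma dot_gt0 n (x : 'rV[R]_n) : x != 0 -> 0 < dot x x.
Proof.
move=> x0; rewrite lt0r dot_ge0 andbT; apply: contra x0 => /eqP xx0.
apply/eqP/rowP => i; rewrite mxE; apply/eqP; rewrite -sqrf_eq0 expr2; apply/eqP.
by apply: (psumr_eq0P _ xx0) => // j _; rewrite -expr2 sqr_ge0.
Qed.

Lemma dot0l n (x : 'rV[R]_n) : dot 0 x = 0.
Proof. by apply: big1 => i _; rewrite mxE mul0r. Qed.

Lemma scal_rs_row_mx r s (p p' : 'rV[R]_r) (n n' : 'rV[R]_s) :
  scal_rs (row_mx p n) (row_mx p' n') = dot p p' - dot n n'.
Proof.
by congr (_ - _); apply: eq_bigr => i _; rewrite ?row_mxEl ?row_mxEr.
Qed.

Lemma scal_rsDl r s (Z Z' W : 'rV[R]_(r + s)) :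
  scal_rs (Z + Z') W = scal_rs Z W + scal_rs Z' W.
Proof. by rewrite -{1}[Z]scale1r scal_rsDZl mul1r. Qed.

Lemma scal_rsNl r s (Z W : 'rV[R]_(r + s)) : scal_rs (- Z) W = - scal_rs Z W.
Proof. by rewrite !scal_rs_gram !mulNmx mxE. Qed.

Lemma scal_rsZZ r s a (Z : 'rV[R]_(r + s)) :
  scal_rs (a *: Z) (a *: Z) = a ^+ 2 * scal_rs Z Z.
Proof. by rewrite !scal_rs_gram linearZ /= -!scalemxAl -scalemxAr !mxE; ring. Qed.

Lemma scal_rs_parallelogram r s (Z W : 'rV[R]_(r + s)) :
  scal_rs (Z + W) (Z + W) + scal_rs (Z - W) (Z - W)
  = 2%:R * (scal_rs Z Z + scal_rs W W).
Proof.
rewrite !scal_rsDl !scal_rsNl ![scal_rs _ (_ + _)]scal_rsC.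
by rewrite !scal_rsDl !scal_rsNl; ring.
Qed.

(** A positive definite subspace meets the negative summand trivially, so it
    projects injectively onto the positive one. *)
Lemma positive_definite_le n r s (A : 'M[R]_(n, r + s)) :
  (forall x : 'rV_n, x != 0 -> 0 < scal_rs (x *m A) (x *m A)) -> (n <= r)%N.
Proof.
move=> Apos; suff /eqP <- : row_free (lsubmx A) by exact: rank_leq_col.
apply: inj_row_free => x xA0; apply/eqP; apply: contraT => /Apos.
rewrite -[x *m A]hsubmxK -!mulmx_lsub -!mulmx_rsub xA0.
by rewrite scal_rs_row_mx dot0l sub0r oppr_gt0 ltNge dot_ge0.
Qed.

Lemma negative_definite_le n r s (A : 'M[R]_(n, r + s)) :
  (forall x : 'rV_n, x != 0 -> scal_rs (x *m A) (x *m A) < 0) -> (n <= s)%N.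
Proof.
move=> Aneg; suff /eqP <- : row_free (rsubmx A) by exact: rank_leq_col.
apply: inj_row_free => x xA0; apply/eqP; apply: contraT => /Aneg.
rewrite -[x *m A]hsubmxK -!mulmx_lsub -!mulmx_rsub xA0.
by rewrite scal_rs_row_mx dot0l subr0 ltNge dot_ge0.
Qed.

(** Comparison of the signatures of two forms that agree up to a positive
    factor on the coordinate summands of R^{t,u}; the negative factor is the
    same statement with the roles of r and s exchanged. *)
Lemma proportional_signature r s t u (D : 'M[R]_(t + u, r + s)) (lam : R) :
  lam != 0 ->
  (forall p : 'rV_t, scal_rs (row_mx p 0 *m D) (row_mx p 0 *m D)
                     = lam * dot p p) ->
  (forall n : 'rV_u, scal_rs (row_mx 0 n *m D) (row_mx 0 n *m D)
                     = - (lam * dot n n)) ->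
  (t <= r)%N /\ (u <= s)%N \/ (t <= s)%N /\ (u <= r)%N.
Proof.
move=> lam0 DP DN.
have uE (p : 'rV_t) : p *m usubmx D = row_mx p 0 *m D.
  by rewrite -[D in RHS]vsubmxK mul_row_col mul0mx addr0.
have dE (n : 'rV_u) : n *m dsubmx D = row_mx 0 n *m D.
  by rewrite -[D in RHS]vsubmxK mul_row_col mul0mx add0r.
case: (ltgtP lam 0) lam0 => // [neg|pos] _.
- right; split.
    apply: (@negative_definite_le t r s (usubmx D)) => x /dot_gt0 x0.
    by rewrite uE DP nmulr_rlt0.
  apply: (@positive_definite_le u r s (dsubmx D)) => x /dot_gt0 x0.
  by rewrite dE DN oppr_gt0 nmulr_rlt0.
- left; split.
    apply: (@positive_definite_le t r s (usubmx D)) => x /dot_gt0 x0.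
    by rewrite uE DP pmulr_rgt0.
  apply: (@negative_definite_le u r s (dsubmx D)) => x /dot_gt0 x0.
  by rewrite dE DN oppr_lt0 pmulr_rgt0.
Qed.

Lemma dot_delta n : dot ('e_ord0 : 'rV[R]_n.+1) 'e_ord0 = 1.
Proof.
rewrite /dot (bigD1 ord0) //= !mxE eqxx mulr1 big1 ?addr0 // => i i0.
by rewrite !mxE (negPf i0) mulr0.
Qed.

Lemma dotZZ n a (x : 'rV[R]_n) : dot (a *: x) (a *: x) = a ^+ 2 * dot x x.
Proof. by rewrite mulr_sumr; apply: eq_bigr => i _; rewrite !mxE; ring. Qed.

(** The parallelogram identity turns the matching of null cones into
    proportionality of the two quadratic forms on the summands of R^{t,u}. *)
Lemma null_cone_signature r s t u (D : 'M[R]_(t + u, r + s))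
    (D' : 'M[R]_(r + s, t + u)) :
  (0 < r)%N -> (0 < s)%N -> D *m D' = 1%:M -> D' *m D = 1%:M ->
  (forall Z, scal_rs Z Z = 0 <-> scal_rs (Z *m D) (Z *m D) = 0) ->
  (t, u) = (r, s) \/ (t, u) = (s, r).
Proof.
move=> r0 s0 DD' D'D cone.
have dims : (t + u)%N = (r + s)%N.
  by apply/eqP; rewrite eqn_leq (mulmx1_min DD') (mulmx1_min D'D).
(* A nonzero null vector of R^{r,s}, pulled back to R^{t,u}, prevents the form
   there from being definite. *)
have [t0 u0] : (0 < t)%N /\ (0 < u)%N.
  case: r r0 D D' DD' D'D cone {dims} => // r _.
  case: s s0 => // s _ D D' DD' D'D cone.
  set N : 'rV[R]_(r.+1 + s.+1) := row_mx 'e_ord0 'e_ord0.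
  have N0 : N != 0.
    apply/eqP => /rowP/(_ (lshift s.+1 ord0)).
    by rewrite row_mxEl !mxE !eqxx => /eqP; rewrite oner_eq0.
  have ND'D : N *m D' *m D = N by rewrite -mulmxA D'D mulmx1.
  have : scal_rs (N *m D') (N *m D') = 0.
    by apply/cone; rewrite ND'D scal_rs_row_mx !dot_delta subrr.
  have ND'0 : N *m D' != 0.
    by apply: contra N0 => /eqP ND'0; rewrite -ND'D ND'0 mul0mx.
  move: (N *m D') ND'0 => {DD' D'D cone ND'D D D'}.
  case: t => [|t]; last case: u => [|u //].
    move=> Z; rewrite -[Z]hsubmxK; move: (lsubmx Z) (rsubmx Z) => p n Z0.
    rewrite scal_rs_row_mx (thinmx0 p) dot0l sub0r => /eqP; rewrite oppr_eq0.
    have n0 : n != 0 by apply: contra Z0 => /eqP ->; rewrite (thinmx0 p) row_mx0.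
    by rewrite (gt_eqF (dot_gt0 n0)).
  move=> Z; rewrite -[Z]hsubmxK; move: (lsubmx Z) (rsubmx Z) => p n Z0.
  rewrite scal_rs_row_mx (thinmx0 n) dot0l subr0 => /eqP.
  have p0 : p != 0 by apply: contra Z0 => /eqP ->; rewrite (thinmx0 n) row_mx0.
  by rewrite (gt_eqF (dot_gt0 p0)).
case: t t0 D D' DD' D'D cone dims => // t _.
case: u u0 => // u _ D D' DD' D'D cone dims.
pose q (Z : 'rV[R]_(t.+1 + u.+1)) := scal_rs (Z *m D) (Z *m D).
(* For p and n of equal Euclidean length, p + n and p - n are both null. *)
have qN (p : 'rV_t.+1) (n : 'rV_u.+1) : dot p p = dot n n ->
    q (row_mx p 0) = - q (row_mx 0 n).
  move=> pn; apply/eqP; rewrite -addr_eq0.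
  have /cone : scal_rs (row_mx p n) (row_mx p n) = 0.
    by rewrite scal_rs_row_mx pn subrr.
  have /cone : scal_rs (row_mx p (- n)) (row_mx p (- n)) = 0.
    by rewrite scal_rs_row_mx pn -scaleN1r dotZZ; ring.
  have -> : row_mx p (- n) = row_mx p 0 - row_mx 0 n.
    by rewrite opp_row_mx add_row_mx oppr0 addr0 add0r.
  have -> : row_mx p n = row_mx p 0 + row_mx 0 n.
    by rewrite add_row_mx addr0 add0r.
  rewrite mulmxBl mulmxDl => m0 p0.
  have := scal_rs_parallelogram (row_mx p 0 *m D) (row_mx 0 n *m D).
  by rewrite m0 p0 addr0 => /esym/eqP; rewrite mulf_eq0 pnatr_eq0.
pose lam := q (row_mx 'e_ord0 0).
(* The first basis vector of the other summand, rescaled to the length of the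
   given vector, is the partner to which qN applies. *)
have DN (n : 'rV_u.+1) : q (row_mx 0 n) = - (lam * dot n n).
  rewrite -[LHS]opprK -(qN (Num.sqrt (dot n n) *: 'e_ord0)); last first.
    by rewrite dotZZ dot_delta mulr1 sqr_sqrtr ?dot_ge0.
  have -> a : row_mx (a *: 'e_ord0 : 'rV_t.+1) 0 = a *: row_mx 'e_ord0 (0 : 'rV_u.+1).
    by rewrite scale_row_mx scaler0.
  by rewrite /q -scalemxAl scal_rsZZ sqr_sqrtr ?dot_ge0 // mulrC.
have DP (p : 'rV_t.+1) : q (row_mx p 0) = lam * dot p p.
  have nE : dot p p = dot (Num.sqrt (dot p p) *: ('e_ord0 : 'rV[R]_u.+1))
                          (Num.sqrt (dot p p) *: 'e_ord0).
    by rewrite dotZZ dot_delta mulr1 sqr_sqrtr ?dot_ge0.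
  by rewrite (qN _ _ nE) DN -nE opprK.
(* If lam were 0, the first basis vector of the positive summand would be
   null. *)
have lam0 : lam != 0.
  apply/eqP => /cone; rewrite scal_rs_row_mx dot0l dot_delta subr0 => /eqP.
  by rewrite oner_eq0.
have := proportional_signature lam0 DP DN.
move=> [[h1 h2]|[h1 h2]]; [left|right]; congr (_, _); lia.
Qed.

End NullCones.

(** * Isomorphisms match the null cones of the centres *)

Section Modules.
Local Open Scope ring_scope.
Variable R : realType.

Section OneModule.
Variables (r s : nat) (M : admissibleModule R r s).

Lemma adm_form_nondeg (v : M) : (forall w, adm_form M v w = 0) -> v = 0.
Proof.
move=> v0; apply/eqP; rewrite -memv0 -(eqP (adm_nondegenerate M)).
by apply/mem_orthovP => w _; exact: v0.
Qed.

Lemma adm_J_sqr Z (v : M) : adm_J M Z (adm_J M Z v) = - scal_rs Z Z *: v.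
Proof.
rewrite /adm_J -comp_lfunE -adm_repM cliff_vec_sqr linearZ /= adm_rep1.
by rewrite scale_lfunE id_lfunE.
Qed.

Lemma adm_J_ker Z (v : M) : v != 0 -> adm_J M Z v = 0 -> scal_rs Z Z = 0.
Proof.
move=> v0 Jv0; have := adm_J_sqr Z v; rewrite Jv0 linear0 => /esym/eqP.
by rewrite scaler_eq0 (negPf v0) orbF oppr_eq0 => /eqP.
Qed.

(** J_Z squares to 0 when Z is null, so from a nonzero v either v itself or
    J_Z v is a nonzero element of the kernel. *)
Lemma adm_J_null Z : scal_rs Z Z = 0 -> exists2 v : M, v != 0 & adm_J M Z v = 0.
Proof.
move=> Z0; have [v v0] : exists v : M, v != 0.
  exists (vpick {:M}); rewrite vpick0 -dimv_eq0 dimvf -lt0n; exact: adm_neq0.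
have [Jv0|Jv0] := eqVneq (adm_J M Z v) 0; first by exists v.
by exists (adm_J M Z v); rewrite // adm_J_sqr Z0 oppr0 scale0r.
Qed.

(** If v is central, nondegeneracy gives J_Z v = 0 for every Z; a basis vector
    Z is not null, so v = 0. *)
Lemma pseudoH_central0 (v : M) : (0 < r + s)%N ->
  (forall w, pseudoH_central v w = 0) -> v = 0.
Proof.
move=> rs0 v0; apply/eqP; apply: contraT => v0'.
pose k := Ordinal rs0; have := scal_rs_delta_sqr R k.
rewrite (@adm_J_ker 'e_k v v0') ?mul0r; first by move/eqP; rewrite eq_sym oner_eq0.
apply: adm_form_nondeg => w.
by rewrite ((pseudoH_centralP _ _ _).2 (erefl (pseudoH_central v w))) v0
  scal_rs_gram trmx0 mulmx0 mxE.
Qed.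

Lemma pseudoH_bracketE (x y : pseudoH_lie M) :
  lie_bracket (pseudoH_lie M) x y = (0, pseudoH_central x.1 y.1).
Proof. by []. Qed.

(** The centre of the Lie algebra is exactly the second summand, which makes it
    visible to isomorphisms that ignore the scalar products. *)
Lemma pseudoH_central_elem (x : pseudoH_lie M) : (0 < r + s)%N ->
  (forall y, lie_bracket (pseudoH_lie M) x y = 0) <-> x.1 = 0.
Proof.
move=> rs0; split=> [x0|x0 y].
  apply: (pseudoH_central0 rs0) => w.
  exact: (congr1 snd (x0 (w, 0))).
rewrite pseudoH_bracketE x0; congr (_, _); apply/rowP => k.
by rewrite !mxE linear0 linear0l mulr0.
Qed.

End OneModule.

Section Isomorphism.
Variables (r s t u : nat).
Variables (V : admissibleModule R r s) (W : admissibleModule R t u).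

Lemma iso_centre (f : {linear pseudoH_lie V -> pseudoH_lie W}) :
  (0 < r + s)%N -> (0 < t + u)%N -> bijective f ->
  (forall x y, f (lie_bracket (pseudoH_lie V) x y)
               = lie_bracket (pseudoH_lie W) (f x) (f y)) ->
  forall x, x.1 = 0 <-> (f x).1 = 0.
Proof.
move=> rs0 tu0 [g fK gK] fM x.
split=> /pseudoH_central_elem xC; apply/pseudoH_central_elem => // y.
  by rewrite -[y]gK -fM xC // linear0.
by apply: (can_inj fK); rewrite fM xC // linear0.
Qed.

Lemma iso_centre_mx (f : {linear pseudoH_lie V -> pseudoH_lie W}) :
  exists C : 'M[R]_(r + s, t + u), forall U, (f (0, U)).2 = U *m C.
Proof.
pose g (U : 'rV[R]_(r + s)) : 'rV[R]_(t + u) := (f (0, U)).2.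
have glin : linear g.
  move=> a X Y; rewrite /g.
  have -> : (0, a *: X + Y) = a *: (0, X) + (0, Y) :> pseudoH_lie V.
    by congr (_, _); rewrite /= scaler0 addr0.
  by rewrite linearP.
pose gL : {linear 'rV[R]_(r + s) -> 'rV[R]_(t + u)} :=
  HB.pack g (GRing.isLinear.Build _ _ _ _ g glin).
by exists (lin1_mx gL) => U; rewrite mul_rV_lin1.
Qed.

End Isomorphism.

(** The matrix D is the adjoint of the map induced on the centres.  By the
    identity JD below, A carries the kernel of J_{Z D} on V onto the kernel of
    J_Z on W. *)
Lemma lie_isomorphic_null_cones r s t u
    (V : admissibleModule R r s) (W : admissibleModule R t u) :
  (0 < r + s)%N -> (0 < t + u)%N ->
  lie_isomorphic (pseudoH_lie V) (pseudoH_lie W) ->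
  exists (D : 'M[R]_(t + u, r + s)) (D' : 'M[R]_(r + s, t + u)),
    [/\ D *m D' = 1%:M, D' *m D = 1%:M &
      forall Z, scal_rs Z Z = 0 <-> scal_rs (Z *m D) (Z *m D) = 0].
Proof.
move=> rs0 tu0 [f [fbij fM]]; have fC := iso_centre rs0 tu0 fbij fM.
case: (fbij) => g fK gK.
have glin : linear g by apply: can2_linear fK gK.
pose gL : {linear pseudoH_lie W -> pseudoH_lie V} :=
  HB.pack g (GRing.isLinear.Build _ _ _ _ g glin).
have gC x : x.1 = 0 <-> (gL x).1 = 0 by rewrite -{1}[x]gK; split=> /fC.
have [C CE] := iso_centre_mx f; have [C' C'E] := iso_centre_mx gL.
have fE U : f (0, U) = (0, U *m C).
  by rewrite [LHS]surjective_pairing CE ((fC (0, U)).1 erefl).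
have gE U : g (0, U) = (0, U *m C').
  by rewrite -/(gL _) [LHS]surjective_pairing C'E ((gC (0, U)).1 erefl).
have CC' : C *m C' = 1%:M.
  apply/row_matrixP => i; rewrite !rowE mulmxA mulmx1.
  by have := fK (0, 'e_i); rewrite fE gE => -[].
have C'C : C' *m C = 1%:M.
  apply/row_matrixP => i; rewrite !rowE mulmxA mulmx1.
  by have := gK (0, 'e_i); rewrite gE fE => -[].
pose A (v : V) : W := (f (v, 0)).1.
have A0 v : v != 0 -> A v != 0.
  by apply: contra => /eqP /(fC (v, 0)).2 /= ->.
have A_surj w : exists v, A v = w.
  exists (g (w, 0)).1; have := gK (w, 0); set x := g _ => xE.
  rewrite /A -[RHS]/((w, 0 : 'rV[R]_(t + u)).1) -xE {2}[x]surjective_pairing.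
  have -> : (x.1, x.2) = (x.1, 0) + (0, x.2) :> pseudoH_lie V.
    by congr (_, _); rewrite ?addr0 ?add0r.
  by rewrite linearD fE /= addr0.
have AM v w : pseudoH_central (A v) (A w) = pseudoH_central v w *m C.
  have := fM (v, 0) (w, 0); rewrite !pseudoH_bracketE fE => -[<-].
  by [].
pose D := scal_adjoint C.
have JD Z v w : adm_form W (adm_J W Z (A v)) (A w)
              = adm_form V (adm_J V (Z *m D) v) w.
  rewrite ((pseudoH_centralP _ _ _).2 erefl Z) AM -scal_adjointP.
  by rewrite ((pseudoH_centralP _ _ _).2 erefl (Z *m D)).
exists D, (scal_adjoint C'); split; try exact: scal_adjoint_inv.
move=> Z; split.
  move=> /(adm_J_null W)[w w0 Jw0]; have [v vE] := A_surj w.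
  have v0 : v != 0.
    apply: contra w0 => /eqP v0; rewrite -vE v0.
    by apply/eqP/(fC (0, 0)).
  apply: (@adm_J_ker _ _ V _ v) => //; apply: adm_form_nondeg => x.
  by rewrite -JD vE Jw0 linear0l.
move=> /(adm_J_null V)[v v0 Jv0].
apply: (@adm_J_ker _ _ W _ (A v)); first exact: A0.
apply: adm_form_nondeg => w; have [x <-] := A_surj w.
by rewrite JD Jv0 linear0l.
Qed.

End Modules.

Theorem theorem3p3 (R : realType) (r s t u : nat)
    (V : admissibleModule R r s) (W : admissibleModule R t u)
    (r_ge1 : 1 <= r) (s_ge1 : 1 <= s) (tu_ge1 : 1 <= t + u)
    (V_min : standard_minimal V) (W_min : standard_minimal W)
    (VW_iso : lie_isomorphic (pseudoH_lie V) (pseudoH_lie W)) :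
  (t, u) = (r, s) \/ (t, u) = (s, r).
Proof.
have rs_gt0 : 0 < r + s by rewrite addn_gt0 r_ge1.
have [D [D' [DD' D'D cone]]] := lie_isomorphic_null_cones rs_gt0 tu_ge1 VW_iso.
exact: null_cone_signature r_ge1 s_ge1 DD' D'D cone.
Qed.
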